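(* As $D\to\infty$, for every $3$-uniform $3$-simple hypergraph $\mathcal{H}$ with maximum degree at most $D$ and every edge $e\in E(\mathcal{H})$, $$b_{L(\mathcal{H}),\,3D}(e)\le 1-\frac{1}{9}+\frac{1}{3^5}+o(1),$$ where the $o(1)$ term depends only on $D$ and tends to $0$ as $D\to\infty$.
   Context: A hypergraph $\mathcal{H}$ consists of a vertex set $V(\mathcal{H})$ and a multiset $E(\mathcal{H})$ of edges, each a subset of $V(\mathcal{H})$ (repeated edges are allowed and copies count as distinct edges). It is $k$-uniform if every edge has size $k$, and $t$-simple if every two distinct edges intersect in at most $t$ vertices (so for a $3$-uniform hypergraph, being $3$-simple is no restriction). The degree of a vertex is the number of edges (with multiplicity) containing it. The line graph $L(\mathcal{H})$ is the simple graph whose vertices are the edges of $\mathcal{H}$ (with multiplicity), two distinct edges being adjacent iff they intersect. For a graph $G$ and $v\in V(G)$, let $P_G(v):=\binom{\deg_G(v)}{2}-|E(N_G(v))|$ be the number of non-adjacent (unordered) pairs of distinct vertices in $N_G(v)$, where $E(N_G(v))$ is the set of edges of $G$ with both ends in $N_G(v)$, and let $T_G(v)$ be the number of $3$-element subsets of $N_G(v)$ that are pairwise non-adjacent in $G$. For a number $M\ge\Delta(G)$, define $$b_{G,M}(v):=\frac{\deg_G(v)}{M}-\frac{P_G(v)}{M^2}+\frac{T_G(v)}{M^3}.$$ *)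

(* Defs.v *)
From HB Require Import structures.
From mathcomp Require Import all_boot all_order all_algebra.

Set Implicit Arguments.
Unset Strict Implicit.
Unset Printing Implicit Defensive.

Import Order.TTheory GRing.Theory Num.Theory.

Local Open Scope ring_scope.

Record sgraph := SGraph {
  vertex :> finType;
  adj : rel vertex;
  adj_sym : symmetric adj;
  adj_irrefl : irreflexive adj
}.

Section Graph.
Variable G : sgraph.
Implicit Types (v : G) (A S : {set G}).

Definition neigh v : {set G} := [set w | adj v w].

Definition gdeg v : nat := #|neigh v|.

Definition max_gdeg : nat := \max_(v : G) gdeg v.

Definition edges_in A : {set {set G}} :=
  [set [set x; y] | x in A, y in A & adj x y].

Definition independent S : bool :=
  [forall x in S, forall y in S, (x != y) ==> ~~ adj x y].

(* The truncated subtraction is exact: see [num_nonadj_pairsE]. *)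
Definition num_nonadj_pairs v : nat :=
  ('C(gdeg v, 2) - #|edges_in (neigh v)|)%N.

Definition num_indep_triples v : nat :=
  #|[set S : {set G} | [&& S \subset neigh v, #|S| == 3 & independent S]]|.

(* Intended for M >= max_gdeg. *)
Definition b_fun (R : realFieldType) (M : R) v : R :=
  (gdeg v)%:R / M - (num_nonadj_pairs v)%:R / M ^+ 2
  + (num_indep_triples v)%:R / M ^+ 3.

Lemma num_nonadj_pairsE v :
  num_nonadj_pairs v =
  #|[set S : {set G} | [&& S \subset neigh v, #|S| == 2 & independent S]]|.
Proof.
rewrite /num_nonadj_pairs /gdeg -cards_draws.
set B := [set S : {set G} | _ & _].
have sEB : edges_in (neigh v) \subset B.
  apply/subsetP => _ /imset2P[x y xN yNxy ->].
  move: yNxy; rewrite inE => /andP[yN xy].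
  rewrite inE subUset !sub1set xN yN cards2 /=.
  by rewrite (contraTneq _ xy) => [|->]; rewrite ?adj_irrefl.
rewrite -[in LHS](setIidPr sEB) -cardsD; apply: eq_card => S.
rewrite !inE andbC -andbA; apply: andb_id2l => sSN; apply: andb_id2l.
move=> /cards2P[x [y [nxy defS]]].
have [xN yN] : x \in neigh v /\ y \in neigh v.
  by move: sSN; rewrite defS subUset !sub1set => /andP.
apply/idP/idP => [nE | indS].
  apply/forall_inP => z zS; apply/forall_inP => w wS; apply/implyP => nzw.
  apply: contra nE => zw; apply/imset2P; exists z w.
  - exact: (subsetP sSN).
  - by rewrite inE zw (subsetP sSN).
  apply/eqP; rewrite eq_sym eqEcard subUset !sub1set zS wS /=.
  by rewrite defS !cards2 nxy nzw.
apply/imset2P => -[z w zN]; rewrite inE => /andP[wN zw] eS.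
have nzw : z != w by apply: contraTneq zw => ->; rewrite adj_irrefl.
move/forall_inP: indS => /(_ z); rewrite eS set21 => /(_ isT)/forall_inP/(_ w).
by rewrite set22 nzw zw => /(_ isT).
Qed.

End Graph.

(* Edges are indexed by a type, so that repeated edges are distinct indices. *)
Record hypergraph := Hypergraph {
  hvertex : finType;
  hedge : finType;
  ends : hedge -> {set hvertex}
}.

Section Hypergraph.
Variable H : hypergraph.
Implicit Types (x : hvertex H) (e f : hedge H).

Definition uniform (k : nat) : Prop := forall e, #|ends e| = k.

Definition tsimple (t : nat) : Prop :=
  forall e f, e != f -> (#|ends e :&: ends f| <= t)%N.

Definition hdeg x : nat := #|[set e | x \in ends e]|.

Definition max_hdeg : nat := \max_(x : hvertex H) hdeg x.

Definition ladj : rel (hedge H) :=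
  fun e f => (e != f) && (ends e :&: ends f != set0).

Lemma ladj_sym : symmetric ladj.
Proof. by move=> e f; rewrite /ladj eq_sym setIC. Qed.

Lemma ladj_irrefl : irreflexive ladj.
Proof. by move=> e; rewrite /ladj eqxx. Qed.

Definition line_graph : sgraph := SGraph ladj_sym ladj_irrefl.

(* M = k * D is admissible in [b_fun] for the line graph. *)
Lemma max_gdeg_line_graph (k D : nat) :
  uniform k -> (max_hdeg <= D)%N -> (max_gdeg line_graph <= k * D)%N.
Proof.
move=> Hk HD; apply/bigmax_leqP => e _.
have sN : neigh (e : line_graph) \subset
    \bigcup_(x in ends e) [set f | x \in ends f].
  apply/subsetP => f; rewrite inE => /andP[_ /set0Pn[x /setIP[xe xf]]].
  by apply/bigcupP; exists x; rewrite ?inE.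
apply: leq_trans (subset_leq_card sN) _.
rewrite -(Hk e) -sum_nat_const.
elim/big_rec2: _ => [|x n A xe leAn]; first by rewrite cards0.
apply: leq_trans (leq_card_setU _ _) (leq_add _ leAn).
exact: leq_trans (leq_bigmax x) HD.
Qed.

End Hypergraph.

(* Main.v *)
Require Import Defs.
From mathcomp Require Import all_boot all_order all_algebra.
From mathcomp Require Import ring lra.

Import Order.TTheory GRing.Theory Num.Theory.
Local Open Scope ring_scope.

(** The bound holds for every [D] with no error term, so the zero sequence is a
valid [o]; the constant is the value at the following extremal configuration,
and the proof is a double count that is tight there.

Let [e = {x, y, z}] and let [A], [B], [C] be the sets of edges that meet [e]
only in [x], only in [y], only in [z].  Such an edge is a vertex of [e] together
with a link, a pair of vertices outside [e].  Three pairwise disjoint edges meeting [e] take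
one vertex of [e] each, so every independent triple of neighbours of [e] comes
from [A * B * C]; and two edges from different classes are non-adjacent exactly
when their links are disjoint.  The edges meeting [e] in two or three vertices
create no independent triple, and they use up degrees of [x], [y], [z], which
gives [2 deg(e) <= |A| + |B| + |C| + 3 D] ([gdeg_le]).

What remains concerns three families of pairs in which every vertex has total
degree at most [D].  Write [p] for the number of disjoint pairs from different
families and [t] for the number of disjoint triples; a large [b] needs [p] small
and [t] large.  By inclusion-exclusion [p] is at least the number of all pairs
minus the number [S] of incidences between families, and [S] is limited by
the degrees.  In the extremal case, up to lower order terms, the links live on the
vertices of a hexagon: the two perfect matchings formed by its sides and the one
formed by its long diagonals make up the three families, each pair being repeated
[D / 3] times.  Every vertex then has degree [D / 3] in each family, [S = 2 D^2] and
[p = D^2]; and two disjoint links from different families leave one pair of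
vertices, which belongs to the third family, so [t = D^3 / 9].  These values give
[1 - 1/9 + 1/3^5].

Away from this case a larger [p] allows a larger [t].  The inequality [disj3_le],
valid for each triple of links separately, bounds [3 t] linearly in [p], in the
incidence counts, and in the number of cherries (one link meeting a link of each
of the other two families).  Both [S] and the cherries are then bounded by sums
over vertices of polynomials in the three degrees, and the combination that
occurs is largest, in proportion to the degree of the vertex, when the three
degrees are [D / 3] ([vertex_le]).
The final comparison is linear in the family sizes, up to products of the
deficits [D - |A|], [D - |B|], [D - |C|] ([nonadj_tradeoff]). *)

(** * Disjoint and intersecting links *)

Section LinkCounting.
Variables (R : realFieldType) (V I : finType) (L : I -> {set V}).
Implicit Types (f g h : I) (A B C : {set I}) (v : V).

Definition ldeg A v : R := #|[set f in A | v \in L f]|%:R.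
Definition meets f g : R := #|L f :&: L g|%:R.
Definition disj f g : R := [disjoint L f & L g]%:R.

Definition meet_sum A B : R := \sum_(f in A) \sum_(g in B) meets f g.
Definition disj_sum A B : R := \sum_(f in A) \sum_(g in B) disj f g.
Definition disj_sum3 A B C : R :=
  \sum_(f in A) \sum_(g in B) \sum_(h in C) (disj f g * disj f h * disj g h).
Definition cherries A B C : R :=
  \sum_(f in A) (\sum_(g in B) meets f g) * (\sum_(h in C) meets f h).

Lemma meetsC f g : meets f g = meets g f.
Proof. by rewrite /meets setIC. Qed.

Lemma disjE f g : disj f g = (#|L f :&: L g| == 0%N)%:R.
Proof. by rewrite /disj -setI_eq0 cards_eq0. Qed.

Lemma disj_ge1B f g : 1 - meets f g <= disj f g.
Proof.
rewrite disjE /meets; case: #|_| => [|n]; first by rewrite subr0.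
by rewrite subr_le0 ler1n.
Qed.

Lemma ldeg_ge0 A v : 0 <= ldeg A v. Proof. exact: ler0n. Qed.

Lemma sum_link A (F : V -> R) :
  \sum_(f in A) \sum_(v in L f) F v = \sum_v ldeg A v * F v.
Proof.
rewrite (exchange_big_dep predT) //=; apply: eq_bigr => v _.
rewrite sumr_const mulr_natl; congr (_ *+ _).
by apply: eq_card => f; rewrite !inE.
Qed.

Lemma ldegE A v : ldeg A v = \sum_(f in A) (v \in L f)%:R.
Proof.
rewrite /ldeg -sum1_card natr_sum; under eq_bigl do rewrite inE.
by rewrite big_mkcondr; apply: eq_bigr => f _; case: ifP.
Qed.

Lemma sum_meets B f : \sum_(g in B) meets f g = \sum_(v in L f) ldeg B v.
Proof.
under [RHS]eq_bigr do rewrite ldegE.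
rewrite exchange_big /=; apply: eq_bigr => g _.
rewrite /meets -sum1_card natr_sum; under eq_bigl do rewrite inE.
by rewrite big_mkcondr; apply: eq_bigr => v _; case: ifP.
Qed.

Lemma meet_sumE A B : meet_sum A B = \sum_v ldeg A v * ldeg B v.
Proof.
by rewrite -sum_link; apply: eq_bigr => f _; rewrite sum_meets.
Qed.

Lemma handshake A : {in A, forall f, #|L f| = 2%N} ->
  \sum_v ldeg A v = 2 * #|A|%:R.
Proof.
move=> A2; under eq_bigr do rewrite -[ldeg _ _]mulr1.
rewrite -(sum_link A (fun=> 1)) mulr_natr -sumr_const.
by apply: eq_bigr => f /A2; rewrite sumr_const => ->.
Qed.

(** Bonferroni: two links that meet do so in at least one vertex. *)
Lemma disj_sum_ge A B :
  #|A|%:R * #|B|%:R - meet_sum A B <= disj_sum A B.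
Proof.
rewrite -natrM mulnC natrM mulr_natr -sumr_const -sumrB.
apply: ler_sum => f _; rewrite -sumr_const -sumrB.
by apply: ler_sum => g _; exact: disj_ge1B.
Qed.

(** At a link [{u, v}] of [A] the left-hand side is [2 (b + b') (c + c')], where
[b, b'] and [c, c'] are the degrees of [u, v] in [B] and in [C].  Since these
degrees need not be ordered alike at [u] and [v], this can exceed
[4 (b c + b' c')]; the squares of [b + c] and [b' + c'] still separate the two
vertices, with equality when all four degrees agree. *)
Lemma cherries_le A B C : {in A, forall f, #|L f| = 2%N} ->
  2 * cherries A B C <= \sum_v ldeg A v * (ldeg B v + ldeg C v) ^+ 2.
Proof.
move=> A2; rewrite -sum_link mulr_sumr; apply: ler_sum => f /A2/eqP.
case/cards2P => u [v [nuv Lf]].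
rewrite !sum_meets Lf !big_setU1 ?inE //= !big_set1.
move: (ldeg B u) (ldeg B v) (ldeg C u) (ldeg C v) => b b' c c'.
have := sqr_ge0 ((b + c) - (b' + c')); have := sqr_ge0 ((b + b') - (c + c')).
lra.
Qed.

(** Source of the inequality: twice the triple product is at most
[disj f g * (2 - meets f h - meets g h)], because the two vertices of [h] lie in
at most one each of the disjoint links [f] and [g].
Writing [disj f g = 1 - meets f g + c], where the correction [c] is 1 for
equal links and 0 otherwise, expanding, bounding [c * (2 - meets f h - meets g h)]
by [2 * c] and averaging over the three roles gives the statement. *)
Lemma disj3_le f g h :
    (#|L f| = 2)%N -> (#|L g| = 2)%N -> (#|L h| = 2)%N ->
  3 * (disj f g * disj f h * disj g h) <=
  (disj f g - meets f g) + (disj f h - meets f h) + (disj g h - meets g h)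
  + (meets f g * meets f h + meets g f * meets g h + meets h f * meets h g).
Proof.
move=> f2 g2 h2; rewrite (meetsC g f) (meetsC h) (meetsC h) !disjE /meets.
have := subset_leq_card (subsetIl (L f) (L g)).
have := subset_leq_card (subsetIl (L f) (L h)).
have := subset_leq_card (subsetIl (L g) (L h)).
rewrite f2 g2.
case: #|L f :&: L g| => [|[|[|//]]]; case: #|L f :&: L h| => [|[|[|//]]];
  case: #|L g :&: L h| => [|[|[|//]]]; move=> _ _ _ /=; lra.
Qed.

Lemma disj_sum3_le A B C :
    {in A, forall f, #|L f| = 2%N} -> {in B, forall f, #|L f| = 2%N} ->
    {in C, forall f, #|L f| = 2%N} ->
  3 * disj_sum3 A B C <=
  #|C|%:R * (disj_sum A B - meet_sum A B)
  + #|B|%:R * (disj_sum A C - meet_sum A C)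
  + #|A|%:R * (disj_sum B C - meet_sum B C)
  + (cherries A B C + cherries B A C + cherries C A B).
Proof.
move=> A2 B2 C2.
pose S3 (F : I -> I -> I -> R) := \sum_(f in A) \sum_(g in B) \sum_(h in C) F f g h.
have S3D F G : S3 (fun f g h => F f g h + G f g h) = S3 F + S3 G.
  rewrite -big_split; apply: eq_bigr => f _; rewrite -big_split.
  by apply: eq_bigr => g _; rewrite -big_split.
have S3AB F : S3 (fun f g _ => F f g) =
    #|C|%:R * \sum_(f in A) \sum_(g in B) F f g.
  rewrite mulr_sumr; apply: eq_bigr => f _; rewrite mulr_sumr.
  by apply: eq_bigr => g _; rewrite sumr_const mulr_natl.
have S3AC F : S3 (fun f _ h => F f h) =
    #|B|%:R * \sum_(f in A) \sum_(h in C) F f h.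
  rewrite mulr_sumr; apply: eq_bigr => f _.
  by rewrite sumr_const mulr_natl.
have S3BC F : S3 (fun _ g h => F g h) =
    #|A|%:R * \sum_(g in B) \sum_(h in C) F g h.
  by rewrite /S3 sumr_const mulr_natl.
have sumB X Y : disj_sum X Y - meet_sum X Y =
    \sum_(f in X) \sum_(g in Y) (disj f g - meets f g).
  by rewrite -sumrB; apply: eq_bigr => f _; rewrite -sumrB.
have -> : cherries A B C = S3 (fun f g h => meets f g * meets f h).
  by apply: eq_bigr => f _; rewrite big_distrlr.
have -> : cherries B A C = S3 (fun f g h => meets g f * meets g h).
  by rewrite /S3 exchange_big; apply: eq_bigr => f _; rewrite big_distrlr.
have -> : cherries C A B = S3 (fun f g h => meets h f * meets h g).
  rewrite /S3; under eq_bigr do rewrite exchange_big.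
  by rewrite exchange_big; apply: eq_bigr => f _; rewrite big_distrlr.
rewrite !sumB -S3AB -S3AC -S3BC -!S3D /S3 mulr_sumr.
apply: ler_sum => f fA; rewrite mulr_sumr.
apply: ler_sum => g gB; rewrite mulr_sumr.
by apply: ler_sum => h hC; apply: disj3_le; [exact: A2 | exact: B2 | exact: C2].
Qed.

(** * The trade-off between disjoint pairs and disjoint triples *)

(** Per-vertex form of the trade-off, with the degrees [x], [y], [z] of one vertex
in the three families.  The left-hand side is a symmetric polynomial that,
at fixed sum [s], is largest at [x = y = z], where it equals
[7 D s^2 / 3 + 2 s^3 / 9]; being superlinear in [s <= D], it is at most
[s] times its value at [s = D] divided by [D]. *)
Lemma vertex_le (D x y z : R) : 0 <= x -> 0 <= y -> 0 <= z -> x + y + z <= D ->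
  7 * D * (x * y + x * z + y * z)
  + (x * (y + z) ^+ 2 + y * (x + z) ^+ 2 + z * (x + y) ^+ 2) / 2
  <= 23 / 9 * D ^+ 2 * (x + y + z).
Proof.
move=> x0 y0 z0; set s := x + y + z => sD.
have s0 : 0 <= s by rewrite !addr_ge0.
have e2 : 3 * (x * y + x * z + y * z) <= s ^+ 2.
  rewrite /s; have := sqr_ge0 (x - y); have := sqr_ge0 (x - z).
  have := sqr_ge0 (y - z); lra.
have e3 : 9 * (3 * (x * y * z)) <= 3 * s * (x * y + x * z + y * z).
  rewrite /s.
  have := mulr_ge0 x0 (sqr_ge0 (y - z)).
  have := mulr_ge0 y0 (sqr_ge0 (x - z)).
  have := mulr_ge0 z0 (sqr_ge0 (x - y)).
  lra.
have -> : x * (y + z) ^+ 2 + y * (x + z) ^+ 2 + z * (x + y) ^+ 2 =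
   s * (x * y + x * z + y * z) + 3 * (x * y * z) by rewrite /s; ring.
set q := x * y + x * z + y * z in e2 e3 *.
have q0 : 0 <= q by rewrite !addr_ge0 ?mulr_ge0.
have D0 : 0 <= D := le_trans s0 sD.
have h1 : D * (3 * q) <= D * s ^+ 2 by apply: ler_wpM2l.
have h2 : s * (3 * q) <= s * s ^+ 2 by apply: ler_wpM2l.
have h3 : s * D * s <= s * D * D by apply: ler_wpM2l => //; apply: mulr_ge0.
have h4 : s * s * s <= s * s * D by apply: ler_wpM2l => //; apply: mulr_ge0.
lra.
Qed.

(** Since [4 a b <= (a + b)^2 <= D (a + b)] at each vertex.  For families of at most
[D] edges this gives at most [D^2] incidences, which controls the loss when the third
family has fewer than [D] edges. *)
Lemma meet_sum_le (D : R) A B :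
    {in A, forall f, #|L f| = 2%N} -> {in B, forall f, #|L f| = 2%N} ->
    (forall v, ldeg A v + ldeg B v <= D) ->
  2 * meet_sum A B <= D * (#|A|%:R + #|B|%:R).
Proof.
move=> A2 B2 degD; rewrite -(ler_pM2l (ltr0n R 2)).
have -> : 2 * (D * (#|A|%:R + #|B|%:R)) = \sum_v D * (ldeg A v + ldeg B v).
  by rewrite -mulr_sumr big_split !handshake //=; ring.
rewrite meet_sumE !mulr_sumr; apply: ler_sum => v _.
have ab0 := addr_ge0 (ldeg_ge0 A v) (ldeg_ge0 B v).
have := ler_wpM2r ab0 (degD v); have := sqr_ge0 (ldeg A v - ldeg B v).
move: (ldeg A v) (ldeg B v) => a b; lra.
Qed.

(** The coefficient [7 D] is [8 D - D]: bounding [p] from below by incidences costs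
[8 D] for each, and summing [disj3_le] gives back the size of the third family,
here approximated by [D]. *)
Lemma degree_tradeoff (D : R) A B C :
    {in A, forall f, #|L f| = 2%N} -> {in B, forall f, #|L f| = 2%N} ->
    {in C, forall f, #|L f| = 2%N} ->
    (forall v, ldeg A v + ldeg B v + ldeg C v <= D) ->
  7 * D * (meet_sum A B + meet_sum A C + meet_sum B C)
  + (cherries A B C + cherries B A C + cherries C A B)
  <= 46 / 9 * D ^+ 2 * (#|A|%:R + #|B|%:R + #|C|%:R).
Proof.
move=> A2 B2 C2 degD.
have hA := cherries_le A B C A2; have hB := cherries_le B A C B2.
have hC := cherries_le C A B C2.
have := ler_sum (P := predT) (index_enum V) (fun v _ => vertex_le _ _ _ _
  (ldeg_ge0 A v) (ldeg_ge0 B v) (ldeg_ge0 C v) (degD v)).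
rewrite -mulr_sumr !big_split /= !handshake //.
rewrite -mulr_sumr -mulr_suml !big_split /= -!meet_sumE.
move: hA hB hC; lra.
Qed.

(** The left-hand side is [81 D^3] times the value of [b] at parameter [3 D], with the
degree of [e] replaced by its bound [(|A| + |B| + |C| + 3 D) / 2]. *)
Lemma nonadj_tradeoff (D : R) A B C :
    {in A, forall f, #|L f| = 2%N} -> {in B, forall f, #|L f| = 2%N} ->
    {in C, forall f, #|L f| = 2%N} ->
    (forall v, ldeg A v + ldeg B v + ldeg C v <= D) ->
    0 <= D -> #|A|%:R <= D -> #|B|%:R <= D -> #|C|%:R <= D ->
  27 / 2 * D ^+ 2 * (#|A|%:R + #|B|%:R + #|C|%:R + 3 * D)
  - 9 * D * (disj_sum A B + disj_sum A C + disj_sum B C)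
  + 3 * disj_sum3 A B C <= 217 / 3 * D ^+ 3.
Proof.
move=> A2 B2 C2 degD D0.
have h3 := disj_sum3_le A B C A2 B2 C2.
have hK := degree_tradeoff D A B C A2 B2 C2 degD.
have pAB := disj_sum_ge A B; have pAC := disj_sum_ge A C.
have pBC := disj_sum_ge B C.
have sAB : 2 * meet_sum A B <= D * (#|A|%:R + #|B|%:R).
  apply: meet_sum_le => // v; have := degD v; have := ldeg_ge0 C v; lra.
have sAC : 2 * meet_sum A C <= D * (#|A|%:R + #|C|%:R).
  apply: meet_sum_le => // v; have := degD v; have := ldeg_ge0 B v; lra.
have sBC : 2 * meet_sum B C <= D * (#|B|%:R + #|C|%:R).
  apply: meet_sum_le => // v; have := degD v; have := ldeg_ge0 A v; lra.
have d0 X Y : 0 <= disj_sum X Y by apply: sumr_ge0 => f _; apply: sumr_ge0.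
have := (d0 A B, d0 A C, d0 B C) => -[[]].
move: h3 hK pAB pAC pBC sAB sAC sBC.
have := ler0n R #|A|; have := ler0n R #|B|; have := ler0n R #|C|.
move: (disj_sum3 _ _ _) => t.
move: (cherries _ _ _ + _ + _) => k.
move: (#|A|%:R) (#|B|%:R) (#|C|%:R) => a b c c0 b0 a0.
move: (disj_sum A B) (disj_sum A C) (disj_sum B C) => p q r.
move: (meet_sum A B) (meet_sum A C) (meet_sum B C) => s u w.
move=> h3 hK hp hq hr hs hu hw p0 q0 r0 aD bD cD.
have {}hs : s <= D ^+ 2.
  have : D * (a + b) <= D * (D + D) by rewrite ler_wpM2l ?lerD.
  lra.
have {}hu : u <= D ^+ 2.
  have : D * (a + c) <= D * (D + D) by rewrite ler_wpM2l ?lerD.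
  lra.
have {}hw : w <= D ^+ 2.
  have : D * (b + c) <= D * (D + D) by rewrite ler_wpM2l ?lerD.
  lra.
(* [disj3_le] weighs each count by the size of the third family; the counts [p],
   [q], [r] and the incidences [s], [u], [w] are moved to the weight [D]. *)
have cp : c * p <= D * p by rewrite ler_wpM2r.
have bq : b * q <= D * q by rewrite ler_wpM2r.
have ar : a * r <= D * r by rewrite ler_wpM2r.
have Dp : D * (a * b - s) <= D * p by rewrite ler_wpM2l.
have Dq : D * (a * c - u) <= D * q by rewrite ler_wpM2l.
have Dr : D * (b * c - w) <= D * r by rewrite ler_wpM2l.
have cs : (D - c) * s <= (D - c) * D ^+ 2 by rewrite ler_wpM2l ?subr_ge0.
have bu : (D - b) * u <= (D - b) * D ^+ 2 by rewrite ler_wpM2l ?subr_ge0.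
have aw : (D - a) * w <= (D - a) * D ^+ 2 by rewrite ler_wpM2l ?subr_ge0.
(* The product [a * b] is at least [D * (a + b) - D^2], as both sizes are at most
   [D]; this makes the remaining comparison linear in the sizes. *)
have e1 : 0 <= D * ((D - a) * (D - b)) by rewrite !mulr_ge0 ?subr_ge0.
have e2 : 0 <= D * ((D - a) * (D - c)) by rewrite !mulr_ge0 ?subr_ge0.
have e3 : 0 <= D * ((D - b) * (D - c)) by rewrite !mulr_ge0 ?subr_ge0.
have l1 : D ^+ 2 * a <= D ^+ 2 * D by rewrite ler_wpM2l ?sqr_ge0.
have l2 : D ^+ 2 * b <= D ^+ 2 * D by rewrite ler_wpM2l ?sqr_ge0.
have l3 : D ^+ 2 * c <= D ^+ 2 * D by rewrite ler_wpM2l ?sqr_ge0.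
lra.
Qed.

(** * Counting by sets of edges *)

Definition disj_pairs A B : {set I * I} :=
  [set p in setX A B | [disjoint L p.1 & L p.2]].

Definition pair_sets A B : {set {set I}} :=
  [set [set p.1; p.2] | p in disj_pairs A B].

Definition disj_triples A B C : {set I * I * I} :=
  [set t in setX (setX A B) C | [&& [disjoint L t.1.1 & L t.1.2],
     [disjoint L t.1.1 & L t.2] & [disjoint L t.1.2 & L t.2]]].

Lemma disj_sum_card A B : disj_sum A B = #|disj_pairs A B|%:R.
Proof.
rewrite /disj_sum pair_big -sum1_card natr_sum.
under [RHS]eq_bigl => p do rewrite !inE.
by rewrite [RHS]big_mkcondr; apply: eq_bigr => p _; rewrite /disj; case: ifP.
Qed.

Lemma disj_sum3_card A B C :
  disj_sum3 A B C = #|disj_triples A B C|%:R.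
Proof.
rewrite /disj_sum3 pair_big pair_big -sum1_card natr_sum.
under [RHS]eq_bigl => p do rewrite !inE.
rewrite [RHS]big_mkcondr; apply: eq_bigr => p _; rewrite /disj.
by do !case: [disjoint _ & _]; rewrite /= ?mulr0 ?mul0r ?mulr1.
Qed.

Lemma pair_setsP A B (S : {set I}) :
  reflect (exists f g, [/\ f \in A, g \in B, [disjoint L f & L g]
                         & S = [set f; g]])
          (S \in pair_sets A B).
Proof.
apply: (iffP imsetP) => [[[f g]]|[f [g [fA gB dfg ->]]]].
  by rewrite !inE => /andP[/andP[fA gB] dfg] ->; exists f, g.
by exists (f, g); rewrite // !inE fA gB.
Qed.

(** Since the families are disjoint, an unordered pair determines which of its
elements lies in [A]. *)
Lemma card_pair_sets A B : [disjoint A & B] ->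
  #|pair_sets A B| = #|disj_pairs A B|.
Proof.
move=> dAB; apply: card_in_imset => -[f g] [f' g'].
rewrite !inE /= => /andP[/andP[fA gB] _] /andP[/andP[f'A g'B] _] eS.
have := set21 f g; rewrite eS !inE => /orP[/eqP ef|/eqP ef].
  have := set22 f g; rewrite eS !inE => /orP[/eqP eg|/eqP-> //].
    by have := disjointFr dAB f'A; rewrite -eg gB.
  by rewrite ef.
by have := disjointFr dAB fA; rewrite ef g'B.
Qed.

Lemma card_pair_sets3 A B C :
    [disjoint A & B] -> [disjoint A & C] -> [disjoint B & C] ->
  (#|disj_pairs A B| + #|disj_pairs A C| + #|disj_pairs B C| =
   #|pair_sets A B :|: pair_sets A C :|: pair_sets B C|)%N.
Proof.
move=> dAB dAC dBC; rewrite -!card_pair_sets //.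
have no (X Y Z S : {set I}) h : [disjoint X & Z] -> [disjoint Y & Z] ->
    S \in pair_sets X Y -> h \in S -> h \in Z -> False.
  move=> dXZ dYZ /pair_setsP[f [g [fX gY _ ->]]].
  by rewrite !inE => /orP[]/eqP->; rewrite ?(disjointFr dXZ fX) ?(disjointFr dYZ gY).
have d1 : pair_sets A B :&: pair_sets A C = set0.
  apply/setP=> S; rewrite !inE; apply/negP=> /andP[SAB /pair_setsP[f [g [_ gC _ eS]]]].
  by apply: (no _ _ C S g dAC dBC SAB) => //; rewrite eS set22.
have d2 : (pair_sets A B :|: pair_sets A C) :&: pair_sets B C = set0.
  apply/setP=> S; rewrite !inE; apply/negP=> /andP[SA /pair_setsP[f [g [fB gC _ eS]]]].
  case/orP: SA => SA.
    by apply: (no _ _ C S g dAC dBC SA) => //; rewrite eS set22.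
  apply: (no _ _ B S f dAB _ SA) => //; first by rewrite disjoint_sym.
  by rewrite eS set21.
by rewrite !cardsU d1 d2 cards0 !subn0.
Qed.

End LinkCounting.

Arguments ldeg {R V I} L A v.
Arguments disj_sum {R V I} L A B.
Arguments disj_sum3 {R V I} L A B C.
Arguments disj_pairs {V I} L A B.
Arguments pair_sets {V I} L A B.
Arguments disj_triples {V I} L A B C.

(** * The neighbourhood of an edge in the line graph *)

Section LineNeighbourhood.
Variables (H : hypergraph) (e : hedge H).
Hypothesis H3 : uniform H 3.
Implicit Types (f g h : hedge H) (x y z v : hvertex H).

Definition only_at x : {set hedge H} := [set f | ends f :&: ends e == [set x]].
Definition link f : {set hvertex H} := ends f :\: ends e.

Lemma card_link x : {in only_at x, forall f, #|link f| = 2%N}.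
Proof.
by move=> f; rewrite inE => /eqP fe; rewrite /link cardsD H3 fe cards1.
Qed.

Lemma only_at_disjoint x y : x != y -> [disjoint only_at x & only_at y].
Proof.
move=> nxy; apply/pred0P => f; rewrite !inE.
by apply: contraNF nxy => /andP[/eqP-> ]; rewrite eqEsubset sub1set inE => /andP[].
Qed.

Lemma only_at_neigh x : only_at x \subset neigh (e : line_graph H).
Proof.
apply/subsetP => f; rewrite !inE /= /ladj => /eqP fe.
rewrite (setIC (ends e)) fe -card_gt0 cards1 andbT.
apply/eqP => ef; have := congr1 (fun A : {set _} => #|A|) fe.
by rewrite -ef setIid H3 cards1.
Qed.

Lemma ladj_link x y f g : x != y -> f \in only_at x -> g \in only_at y ->
  ladj f g = ~~ [disjoint link f & link g].
Proof.
move=> nxy fx gy.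
have -> : ladj f g = (ends f :&: ends g != set0).
  rewrite /ladj andb_idl // => _; apply: contraTneq fx => ->.
  by rewrite (disjointFl (only_at_disjoint _ _ nxy) gy).
rewrite -setI_eq0; congr (_ != set0).
apply/setP => v; rewrite !inE; case ve: (v \in ends e) => //=.
apply/negP => /andP[vf vg].
move: fx gy; rewrite !inE => /eqP/setP/(_ v) + /eqP/setP/(_ v).
rewrite !inE vf vg ve /= => /esym/eqP-> /esym.
by apply/negP.
Qed.

Lemma ldeg_link_le (R : realFieldType) D x y z v :
    x != y -> x != z -> y != z -> (max_hdeg H <= D)%N ->
  ldeg link (only_at x) v + ldeg link (only_at y) v
  + ldeg link (only_at z) v <= D%:R :> R.
Proof.
move=> nxy nxz nyz HD; rewrite -!natrD ler_nat.
apply: leq_trans HD; apply: leq_trans (leq_bigmax v).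
pose S x := [set f in only_at x | v \in link f].
have dS a b : a != b -> S a :&: S b = set0.
  move=> nab; apply/setP => f; rewrite in_set0; apply/negP.
  rewrite !inE => /andP[/andP[fa _] /andP[fb _]].
  by have /pred0P/(_ f) := only_at_disjoint _ _ nab; rewrite /= !inE fa fb.
have -> : (#|S x| + #|S y| + #|S z| = #|S x :|: S y :|: S z|)%N.
  by rewrite !cardsU setIUl !dS // setU0 cards0 !subn0.
apply: subset_leq_card; apply/subsetP => f; rewrite !inE.
by case/orP => [/orP[]|] /and3P[].
Qed.

Lemma card_only_at x D : x \in ends e -> (max_hdeg H <= D)%N ->
  (#|only_at x| <= D)%N.
Proof.
move=> xe HD; apply: leq_trans HD; apply: leq_trans (leq_bigmax x).
apply: subset_leq_card; apply/subsetP => f; rewrite !inE => /eqP/setP/(_ x).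
by rewrite !inE eqxx => /andP[].
Qed.

(** In the degree sum over the vertices of [e], a neighbour is counted once for each
vertex it shares with [e]: at least twice, unless it meets [e] in a single vertex. *)
Lemma gdeg_le D : (max_hdeg H <= D)%N ->
  (2 * gdeg (e : line_graph H) <= \sum_(x in ends e) #|only_at x| + 3 * D)%N.
Proof.
move=> HD.
have degE : (\sum_(x in ends e) hdeg x = \sum_f #|ends f :&: ends e|)%N.
  under eq_bigr => x _ do rewrite /hdeg -sum1_card.
  rewrite (exchange_big_dep predT) //=; apply: eq_bigr => f _.
  by rewrite sum1_card; apply: eq_card => x; rewrite unfold_in !inE andbC.
have onlyE : (\sum_(x in ends e) #|only_at x| =
    \sum_f #|[set x in ends e | f \in only_at x]|)%N.
  under eq_bigr => x _ do rewrite -sum1_card.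
  rewrite (exchange_big_dep predT) //=; apply: eq_bigr => f _.
  by rewrite sum1_card; apply: eq_card => x; rewrite unfold_in !inE.
have : (\sum_(x in ends e) hdeg x <= 3 * D)%N.
  rewrite -(H3 e) -sum_nat_const; apply: leq_sum => x _.
  exact: leq_trans (leq_bigmax x) HD.
rewrite degE onlyE => degD.
apply: leq_trans (leq_add (leqnn _) degD).
rewrite -big_split /= mulnC /gdeg -sum_nat_const [X in (X <= _)%N]big_mkcond.
apply: leq_sum => f _; case: ifP => //.
rewrite inE /= /ladj setIC -card_gt0 => /andP[_].
rewrite leq_eqVlt => /orP[|two]; last exact: leq_trans two (leq_addl _ _).
rewrite eq_sym => /cards1P[x fx].
rewrite fx cards1 addn1 ltnS card_gt0; apply/set0Pn; exists x.
rewrite !inE fx eqxx andbT.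
by have := set11 x; rewrite -fx inE => /andP[].
Qed.

Lemma nonadj_pairs_ge x y z : x != y -> x != z -> y != z ->
  (#|disj_pairs link (only_at x) (only_at y)|
   + #|disj_pairs link (only_at x) (only_at z)|
   + #|disj_pairs link (only_at y) (only_at z)|
   <= num_nonadj_pairs (e : line_graph H))%N.
Proof.
move=> nxy nxz nyz; rewrite card_pair_sets3 ?only_at_disjoint //.
rewrite num_nonadj_pairsE; apply: subset_leq_card.
have sub a b : a != b -> pair_sets link (only_at a) (only_at b) \subset
    [set S : {set line_graph H} |
      [&& S \subset neigh (e : line_graph H), #|S| == 2 & independent S]].
  move=> nab; apply/subsetP => _ /pair_setsP[f [g [fa gb dfg ->]]].
  have fg : ~~ ladj f g by rewrite (ladj_link _ _ _ _ nab fa gb) dfg.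
  have nfg : f != g.
    by apply: contraTneq fa => ->; rewrite (disjointFl (only_at_disjoint _ _ nab) gb).
  rewrite inE subUset !sub1set.
  rewrite (subsetP (only_at_neigh _) _ fa) (subsetP (only_at_neigh _) _ gb).
  rewrite cards2 nfg /=.
  apply/forall_inP => u uS; apply/forall_inP => w wS; apply/implyP.
  move: uS wS; rewrite !inE => /orP[]/eqP-> /orP[]/eqP->; rewrite ?eqxx //.
  by move=> _; rewrite /= ladj_sym.
by rewrite !subUset !sub.
Qed.

(** Choosing for each edge of an independent triple a vertex that it shares with [e]
is injective by disjointness, hence a bijection onto the three vertices of [e]; so
no edge of the triple contains a second vertex of [e]. *)
Lemma indep_triples_le x y z : ends e = [set x; y; z] ->
    x != y -> x != z -> y != z ->
  (num_indep_triples (e : line_graph H) <=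
   #|disj_triples link (only_at x) (only_at y) (only_at z)|)%N.
Proof.
move=> exyz nxy nxz nyz.
apply: leq_trans (leq_imset_card (fun t => [set t.1.1; t.1.2; t.2]) _).
apply: subset_leq_card; apply/subsetP => S; rewrite inE => /and3P[SN /eqP S3 iS].
have indep f g : f \in S -> g \in S -> f != g -> ends f :&: ends g = set0.
  move=> fS gS nfg; move/forall_inP: iS => /(_ f fS)/forall_inP/(_ g gS).
  by rewrite nfg /= /ladj nfg negbK => /eqP.
pose psi f := odflt x [pick v in ends f :&: ends e].
have psiP f : f \in S -> psi f \in ends f :&: ends e.
  move=> fS; rewrite /psi; case: pickP => //= no.
  have := subsetP SN _ fS; rewrite inE /= /ladj => /andP[_ /set0Pn[v vI]].
  by have := no v; rewrite setIC vI.
have psi_uniq f g v : f \in S -> g \in S -> v \in ends f -> v \in ends g -> f = g.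
  move=> fS gS vf vg; apply/eqP; apply: contraT => nfg.
  by have /setP/(_ v) := indep f g fS gS nfg; rewrite !inE vf vg.
have psi_inj : {in S &, injective psi}.
  move=> f g fS gS E; apply: (psi_uniq f g (psi f)) => //.
    by have := psiP f fS; rewrite inE => /andP[].
  by have := psiP g gS; rewrite E inE => /andP[].
have psiS : psi @: S = ends e.
  apply/eqP; rewrite eqEcard H3 card_in_imset // S3 leqnn andbT.
  by apply/subsetP => _ /imsetP[f /psiP + ->]; rewrite inE => /andP[].
have at_end v : v \in ends e -> exists2 f, f \in S & f \in only_at v.
  rewrite -psiS => /imsetP[f fS ->]; exists f => //.
  rewrite inE eqEsubset sub1set psiP // andbT; apply/subsetP => w.
  rewrite !inE => /andP[wf]; rewrite -psiS => /imsetP[g gS ew].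
  have := psiP g gS; rewrite -ew inE => /andP[wg _].
  by rewrite ew (psi_uniq f g w).
have [f fS fx] : exists2 f, f \in S & f \in only_at x
  by apply: at_end; rewrite exyz !inE eqxx.
have [g gS gy] : exists2 f, f \in S & f \in only_at y
  by apply: at_end; rewrite exyz !inE eqxx orbT.
have [h hS hz] : exists2 f, f \in S & f \in only_at z
  by apply: at_end; rewrite exyz !inE eqxx orbT.
have ne a b u w : a != b -> u \in only_at a -> w \in only_at b -> u != w.
  move=> nab ua wb; apply: contraTneq ua => ->.
  by rewrite (disjointFl (only_at_disjoint _ _ nab) wb).
have dl u w : u \in S -> w \in S -> u != w -> [disjoint link u & link w].
  move=> uS wS nuw; rewrite -setI_eq0 -subset0 -(indep u w) //.
  by apply: setISS; apply: subsetDl.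
have nfg := ne _ _ _ _ nxy fx gy; have nfh := ne _ _ _ _ nxz fx hz.
have ngh := ne _ _ _ _ nyz gy hz.
apply/imsetP; exists (f, g, h).
  by rewrite inE !in_setX fx gy hz !dl.
apply/esym/eqP; rewrite eqEcard !subUset !sub1set fS gS hS S3 /=.
by rewrite setUC cardsU1 cards2 !inE negb_or (eq_sym h) nfh (eq_sym h) ngh nfg.
Qed.

End LineNeighbourhood.

Arguments only_at {H} e x.
Arguments link {H} e f.

Lemma b_line_graph_le (R : realFieldType) (D : nat) (H : hypergraph) :
  uniform H 3 -> (max_hdeg H <= D)%N -> forall e : hedge H,
  b_fun (G := line_graph H) ((3 * D)%:R : R) e <= 1 - 1 / 9 + 1 / 3 ^+ 5.
Proof.
move=> H3 HD e.
have [x [y [z [exyz nxy nxz nyz]]]] : exists x y z,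
    [/\ ends e = [set x; y; z], x != y, x != z & y != z].
  have : (0 < #|ends e|)%N by rewrite H3.
  case/card_gt0P => x xe.
  have : #|ends e :\ x| == 2.
    have := cardsD1 x (ends e); rewrite xe H3 add1n => /eqP.
    by rewrite eqSS eq_sym.
  case/cards2P => y [z [nyz eyz]].
  have : x \notin ends e :\ x by rewrite !inE eqxx.
  rewrite eyz !inE negb_or => /andP[nxy nxz]; exists x, y, z; split => //.
  by rewrite -(setD1K xe) eyz setUA.
have D_gt0 : (0 < D)%N.
  apply: leq_trans HD; apply: leq_trans (leq_bigmax x).
  by apply/card_gt0P; exists e; rewrite inE exyz !inE eqxx.
have xe : x \in ends e by rewrite exyz !inE eqxx.
have ye : y \in ends e by rewrite exyz !inE eqxx orbT.
have ze : z \in ends e by rewrite exyz !inE eqxx orbT.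
pose A := only_at e.
have cA v : v \in ends e -> #|A v|%:R <= D%:R :> R.
  by move=> ve; rewrite ler_nat card_only_at.
have := nonadj_tradeoff R _ _ (link e) D%:R (A x) (A y) (A z)
  (card_link H e H3 x) (card_link H e H3 y) (card_link H e H3 z)
  (fun v => ldeg_link_le H e R D x y z v nxy nxz nyz HD)
  (ler0n R D) (cA x xe) (cA y ye) (cA z ze).
rewrite !disj_sum_card disj_sum3_card -!natrD.
have := gdeg_le H e H3 D HD.
have -> : (\sum_(v in ends e) #|only_at e v| = #|A x| + #|A y| + #|A z|)%N.
  rewrite exyz -setUA !big_setU1 ?big_set1 ?inE ?negb_or ?nxy ?nxz //=.
  by rewrite addnA.
have := nonadj_pairs_ge H e H3 x y z nxy nxz nyz.
have := indep_triples_le H e H3 x y z exyz nxy nxz nyz.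
rewrite -/A /b_fun.
move: (gdeg _) (num_nonadj_pairs _) (num_indep_triples _) => d P T.
move: (#|disj_triples _ _ _ _|) => t tT.
move: (_ + #|disj_pairs _ _ _|)%N => p pP.
move: (_ + #|A z|)%N => n nd.
move: tT pP nd; rewrite -!(ler_nat R) (natrD R n) (natrM R 2 d) (natrM R 3 D).
have : 0 < D%:R :> R by rewrite ltr0n.
move: (D%:R) (d%:R) (P%:R) (T%:R) (t%:R) (p%:R) (n%:R : R).
move=> r dr Pr Tr tr pr nr r0 tT pP nd main.
have -> : dr / (3 * r) - Pr / (3 * r) ^+ 2 + Tr / (3 * r) ^+ 3 =
    (27 * r ^+ 2 * dr - 9 * r * Pr + 3 * Tr) / (81 * r ^+ 3).
  by field; rewrite gt_eqF.
rewrite ler_pdivrMr ?mulr_gt0 ?exprn_gt0 ?ltr0n //.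
have h1 : r ^+ 2 * (2 * dr) <= r ^+ 2 * (nr + 3 * r) by rewrite ler_wpM2l ?sqr_ge0.
have h2 : r * pr <= r * Pr by rewrite ler_wpM2l ?(ltW r0).
lra.
Qed.

From mathcomp Require Import all_classical all_reals all_analysis.

Import Order.TTheory GRing.Theory Num.Theory.
Import numFieldNormedType.Exports.

Local Open Scope classical_set_scope.
Local Open Scope ring_scope.

Theorem lemma3p3 (R : realType) :
  exists o : nat -> R,
    o n @[n --> \oo] --> (0 : R) /\
    forall (D : nat) (H : hypergraph),
      uniform H 3 -> tsimple H 3 -> (max_hdeg H <= D)%N ->
      forall e : hedge H,
        b_fun (G := line_graph H) ((3 * D)%:R : R) e
          <= 1 - 1 / 9 + 1 / 3 ^+ 5 + o D.
Proof.
exists (fun=> 0); split; first exact: cvg_cst.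
by move=> D H H3 _ HD e; rewrite addr0; apply: b_line_graph_le.
Qed.
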